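(* Let $S$ be an LO monoid. An $S$-act $A$ is pure injective if and only if, for any $S$-acts $B\leq_p C$ such that $|C|\leq|S|+\aleph_0$, every $S$-homomorphism $f:B\to A$ can be extended to an $S$-homomorphism from $C$ to $A$.
   Context: Let $S$ be a monoid with identity $1$; $|S|$ is its cardinality. A (left) $S$-act is a non-empty set $A$ with a map $S\times A\to A$ such that $1a=a$ and $s(ta)=(st)a$ for all $s,t\in S$, $a\in A$. A map $f:A\to B$ of $S$-acts is an $S$-homomorphism if $f(sa)=sf(a)$ for all $s,a$. The language of $S$-acts has one unary function symbol for each $s\in S$; a pp-formula is a formula built from atomic formulas using only conjunctions and existential quantifiers (so it expresses solvability of a finite system of equations of the form $sx=ty$). An $S$-homomorphism $f:A\to B$ is a pure embedding if for every pp-formula $\varphi(\overline{x})$ and tuple $\overline{a}$ from $A$, $A\models\varphi(\overline{a})$ iff $B\models\varphi(f(\overline{a}))$ (in particular $f$ is injective). $A\leq_p B$ (pure subact) means $A\subseteq B$ and the inclusion is a pure embedding. An $S$-act $A$ is pure injective if for any $S$-acts $B\leq_p C$, every $S$-homomorphism $f:B\to A$ can be extended to an $S$-homomorphism $g:C\to A$ (i.e. $g\upharpoonright B=f$). $S$ is LO (locally linearly preordered) if for every $s,t\in S$ we have $s\in St$ or $t\in Ss$. *)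

(* Defs.v *)
From HB Require Import structures.
From mathcomp Require Import all_boot.
From mathcomp Require Import boolp classical_sets functions cardinality.

Set Implicit Arguments.
Unset Strict Implicit.
Unset Printing Implicit Defensive.

Local Open Scope classical_set_scope.

Record sact (S : monoidType) := SAct {
  sact_sort :> Type;
  sact_inh : inhabited sact_sort;
  sact_op : S -> sact_sort -> sact_sort;
  sact1 : forall a, sact_op 1%g a = a;
  sactM : forall s t a, sact_op s (sact_op t a) = sact_op (s * t)%g a }.

Definition shom (S : monoidType) (A B : sact S) (f : A -> B) : Prop :=
  forall s a, f (sact_op s a) = sact_op s (f a).

(* Terms and pp-formulas with free variables among x_0, ..., x_{n-1}.  [PPEx]
   binds the variable of index 0 and shifts the other ones by one. *)
Inductive term (S : monoidType) (n : nat) : Type :=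
| TVar of 'I_n
| TApp of S & term S n.

Inductive ppformula (S : monoidType) : nat -> Type :=
| PPEq n of term S n & term S n : ppformula S n
| PPAnd n of ppformula S n & ppformula S n : ppformula S n
| PPEx n of ppformula S n.+1 : ppformula S n.

Fixpoint teval (S : monoidType) (A : sact S) n (a : n.-tuple A)
    (t : term S n) : A :=
  match t with
  | TVar i => tnth a i
  | TApp s u => sact_op s (teval a u)
  end.

Fixpoint ppsat (S : monoidType) (A : sact S) n (phi : ppformula S n) :
    n.-tuple A -> Prop :=
  match phi in ppformula _ m return m.-tuple A -> Prop with
  | PPEq _ t u => fun a => teval a t = teval a u
  | PPAnd _ p q => fun a => ppsat p a /\ ppsat q a
  | PPEx _ p => fun a => exists x : A, ppsat p [tuple of x :: a]
  end.

Definition pure_embedding (S : monoidType) (A B : sact S) (f : A -> B) : Prop :=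
  shom f /\ forall n (phi : ppformula S n) (a : n.-tuple A),
    ppsat phi a <-> ppsat phi (map_tuple f a).

Record subact (S : monoidType) (C : sact S) := Subact {
  subact_set : set C;
  subact_neq0 : subact_set !=set0;
  subact_closed : forall s a, subact_set a -> subact_set (sact_op s a) }.

Section SubactAsAct.
Variables (S : monoidType) (C : sact S) (B : subact C).

Definition subact_op (s : S) (b : subact_set B) : subact_set B :=
  exist _ (sact_op s (val b)) (mem_set (subact_closed s (set_mem (valP b)))).

Lemma subact_inh : inhabited (subact_set B).
Proof. by have [a Ba] := subact_neq0 B; exists; exists a; apply: mem_set. Qed.

Lemma subact1 b : subact_op 1%g b = b.
Proof. by apply: val_inj; rewrite /= sact1. Qed.

Lemma subactM s t b : subact_op s (subact_op t b) = subact_op (s * t)%g b.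
Proof. by apply: val_inj; rewrite /= sactM. Qed.

Definition sact_of_subact : sact S := SAct subact_inh subact1 subactM.

End SubactAsAct.

Coercion sact_of_subact : subact >-> sact.

Definition subact_incl (S : monoidType) (C : sact S) (B : subact C) : B -> C :=
  fun b => val b.

Definition pure_subact (S : monoidType) (C : sact S) (B : subact C) : Prop :=
  pure_embedding (@subact_incl S C B).

Definition pure_injective (S : monoidType) (A : sact S) : Prop :=
  forall (C : sact S) (B : subact C), pure_subact B ->
  forall f : B -> A, shom f ->
  exists g : C -> A, shom g /\ forall b : B, g (subact_incl b) = f b.

Definition LO (S : monoidType) : Prop :=
  forall s t : S, (exists u, s = (u * t)%g) \/ (exists u, t = (u * s)%g).

(* Main.v *)
(** Over an LO monoid every pp-formula is equivalent to a conjunction of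
    equations and of pp-formulas in one variable, so a subact [D] of [C] is pure
    as soon as each [d] in [D] satisfies the same one-variable pp-formulas in
    [D] and in [C]; hence unions of pure subacts are pure.  By Zorn's lemma,
    extend [f] to a maximal pure subact [D].  If [c] is outside [D], a
    Löwenheim-Skolem argument gives a pure subact [E] of size at most
    [|S| + aleph_0] that contains [c], meets [D], and such that [D `&` E] is
    pure.  The hypothesis extends the map from [D `&` E] to [E], and gluing
    along [D `&` E] contradicts the maximality of [D]. *)

Require Import Defs.
From mathcomp Require Import all_boot.
From mathcomp Require Import boolp classical_sets functions cardinality.
Local Open Scope classical_set_scope.
Local Open Scope card_scope.
Set Implicit Arguments.
Unset Strict Implicit.
Unset Printing Implicit Defensive.

(** * Zorn's lemma for partial functions *)

(** The second hypothesis is local because any two points in the union of a chain lie in a single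
    member of it. *)
Lemma zorn_partial_fun (T V : Type) (Q : set T -> (T -> V) -> Prop)
    (D0 : set T) (f0 : T -> V) :
  Q D0 f0 ->
  (forall D f, D0 `<=` D ->
     (forall x y, D x -> D y -> exists D' f',
        [/\ D' x, D' y, D' `<=` D, Q D' f' & forall z, D' z -> f z = f' z]) ->
     Q D f) ->
  exists D f, [/\ Q D f, D0 `<=` D, forall z, D0 z -> f z = f0 z &
    forall D' f', D `<=` D' -> (forall z, D z -> f' z = f z) -> Q D' f' ->
      D' `<=` D].
Proof.
move=> Q0 Qlocal.
pose ext (p q : set T * (T -> V)) :=
  p.1 `<=` q.1 /\ forall z, p.1 z -> q.2 z = p.2 z.
have ext_refl p : ext p p by split.
have ext_trans p q r : ext p q -> ext q r -> ext p r.
  move=> [pq fpq] [qr fqr]; split=> [z /pq/qr//|z pz].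
  by rewrite fqr ?fpq//; apply: pq.
pose P := {p : set T * (T -> V) | Q p.1 p.2 /\ ext (D0, f0) p}.
have t0 : P by exists (D0, f0); split; [|exact: ext_refl].
pose R (p q : P) := `[< ext (sval p) (sval q) >].
have [||A totA|[[D f] [QD [D0D fD0]]] maxD] := @ZL_preorder P t0 R.
- by move=> p; apply/asboolP; exact: ext_refl.
- move=> p q r /asboolP pq /asboolP qr; apply/asboolP.
  exact: ext_trans pq qr.
- have [[p0 Ap0]|A0] := pselect (A !=set0); last first.
    by exists t0 => s As; case: A0; exists s.
  pose D : set T := [set z | exists2 p, A p & (sval p).1 z].
  have sub p : A p -> (sval p).1 `<=` D by move=> Ap z pz; exists p.
  pose f z := if pselect (D z) is left Dz
    then (sval (sval (cid2 Dz))).2 z else f0 z.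
  have fE p z : A p -> (sval p).1 z -> f z = (sval p).2 z.
    move=> Ap pz; rewrite /f; case: pselect => [Dz|[]]; last by exists p.
    case: (cid2 Dz) => q Aq qz /=.
    by have [/asboolP[_ ->]|/asboolP[_ ->]] := totA _ _ Ap Aq.
  have D0D : D0 `<=` D.
    by move=> z D0z; apply: (sub _ Ap0); apply: (svalP p0).2.1.
  have QD : Q D f.
    apply: Qlocal => // x y [p Ap px] [q Aq qy].
    suff [r Ar [rx ry]] : exists2 r, A r & (sval r).1 x /\ (sval r).1 y.
      exists (sval r).1, (sval r).2; split=> //; first exact: sub.
        exact: (svalP r).1.
      by move=> z; exact: fE.
    have [/asboolP[pq _]|/asboolP[qp _]] := totA _ _ Ap Aq.
      by exists q => //; split=> //; exact: pq.
    by exists p => //; split=> //; exact: qp.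
  have extD : ext (D0, f0) (D, f).
    split=> //= z D0z; rewrite (fE _ _ Ap0); last exact: (svalP p0).2.1.
    exact: (svalP p0).2.2.
  exists (exist _ (D, f) (conj QD extD)) => s As; apply/asboolP.
  by split=> /= [|z]; [exact: sub|exact: fE].
exists D, f; split=> // D' f' DD' ff' QD'.
have eD' : ext (D0, f0) (D', f').
  by apply: (ext_trans _ (D, f)).
have /maxD/asboolP[] // : R (exist _ (D, f) (conj QD (conj D0D fD0)))
    (exist _ (D', f') (conj QD' eD')).
by apply/asboolP.
Qed.

(** * Cardinal arithmetic of infinite types *)

(** A maximal partial injection from [X] to [Y] is either defined on all of [X] or onto [Y], and
    then it can be inverted. *)
Lemma injective_comparable (T : Type) (X Y : set T) :
  (exists f : T -> T, (forall x, X x -> Y (f x)) /\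
     forall x y, X x -> X y -> f x = f y -> x = y) \/
  (exists f : T -> T, (forall x, Y x -> X (f x)) /\
     forall x y, Y x -> Y y -> f x = f y -> x = y).
Proof.
pose Q (D : set T) (f : T -> T) := [/\ D `<=` X, forall x, D x -> Y (f x) &
  forall x y, D x -> D y -> f x = f y -> x = y].
have [||D [f [[DX fY finj] _ _ maxD]]] := @zorn_partial_fun _ _ Q set0 id.
- by split.
- move=> D f _ loc; split.
  + by move=> x Dx; have [D' [f' [D'x _ _ [+ _ _] _]]] := loc x x Dx Dx; apply.
  + move=> x Dx; have [D' [f' [D'x _ _ [_ + _] ->//]]] := loc x x Dx Dx.
    exact.
  + move=> x y Dx Dy; have [D' [f' [D'x D'y _ [_ _ inj] E]]] := loc x y Dx Dy.
    by rewrite !E//; exact: inj.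
have [XD|/existsNP[a /not_implyP[Xa nDa]]] := pselect (X `<=` D).
  left; exists f; split=> [x /XD|x y /XD Dx /XD Dy]; first exact: fY.
  exact: finj.
right.
have onto y : Y y -> exists2 x, D x & f x = y.
  move=> Yy; apply: contrapT => ny; apply: (nDa).
  pose f' z := if pselect (z = a) then y else f z.
  have f'a : f' a = y by rewrite /f'; case: pselect.
  have f'D z : D z -> f' z = f z.
    by rewrite /f'; case: pselect => // za Dz; case: nDa; rewrite -za.
  apply: (maxD (D `|` [set a]) f'); [by move=> z; left|by []| |by right].
  split.
  + by move=> z [/DX//|->].
  + by move=> z [Dz|->]; rewrite ?f'a// f'D//; exact: fY.
  + move=> z1 z2 [D1|->] [D2|->] //; rewrite ?f'a ?f'D//.
    * exact: finj.
    * by move=> E; case: ny; exists z1.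
    * by move=> E; case: ny; exists z2.
pose g y := if pselect (Y y) is left Yy then sval (cid2 (onto y Yy)) else y.
have gE y : Y y -> D (g y) /\ f (g y) = y.
  move=> Yy; rewrite /g; case: pselect => // Yy'.
  by case: cid2 => x Dx E.
exists g; split=> [y /gE[/DX]//|x y /gE[_ E1] /gE[_ E2] E].
by rewrite -E1 E E2.
Qed.

(* Hessenberg's theorem: a maximal injection [f : X * X -> X], with [X]
   containing a countable set, satisfies [|X| = |K|], as otherwise it extends
   to a larger square [(X `|` h @` X) * (X `|` h @` X)]. *)
Lemma square_injection (K : Type) (e : nat -> K) :
  injective e -> exists f : K * K -> K, injective f.
Proof.
move=> e_inj.
pose e' x :=
  if pselect (exists n, e n = x) is left p then sval (cid p) else 0%N.
have eK n : e' (e n) = n.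
  rewrite /e'; case: pselect => [p|[]]; last by exists n.
  by case: cid => m /= /e_inj.
pose N (p : K * K) := range e p.1 /\ range e p.2.
pose f0 p := e (choice.pickle (e' p.1, e' p.2)).
pose Q (D : set (K * K)) f := [/\ forall a b, D (a, b) <-> D (a, a) /\ D (b, b),
  forall p, D p -> D (f p, f p) & forall p q, D p -> D q -> f p = f q -> p = q].
have [||D [f [[Dsq fD finj] ND _ maxD]]] := @zorn_partial_fun _ _ Q N f0.
- split=> [a b|p [_ _]|[a1 b1] [a2 b2]].
  + by rewrite /N/=; tauto.
  + by split; exists (choice.pickle (e' p.1, e' p.2)).
  + move=> [[m1 _ /= <-] [n1 _ /= <-]] [[m2 _ /= <-] [n2 _ /= <-]].
    by move=> /e_inj/(pcan_inj choice.pickleK)/=; rewrite !eK => -[-> ->].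
- move=> D f _ loc; split.
  + move=> a b; split=> [Dab|[Da Db]].
      have [D' [f' [D'ab _ sub [/(_ a b)[D'sq _] _ _] _]]] := loc _ _ Dab Dab.
      by have [/sub ? /sub ?] := D'sq D'ab.
    have [D' [f' [D'a D'b sub [D'sq _ _] _]]] := loc _ _ Da Db.
    by apply: sub; apply/D'sq.
  + move=> p Dp; have [D' [f' [D'p _ sub [_ f'D' _] E]]] := loc p p Dp Dp.
    by apply: sub; rewrite E//; exact: f'D'.
  + move=> p q Dp Dq; have [D' [f' [D'p D'q _ [_ _ inj] E]]] := loc p q Dp Dq.
    by rewrite !E//; exact: inj.
pose X x := D (x, x).
have Xe n : X (e n) by apply: ND; split; exists n.
have XD a b : X a -> X b -> D (a, b) by move=> Xa Xb; apply/Dsq.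
have fX a b : X a -> X b -> X (f (a, b)) by move=> Xa Xb; exact/fD/XD.
have fI a b c d : X a -> X b -> X c -> X d -> f (a, b) = f (c, d) ->
    a = c /\ b = d.
  by move=> Xa Xb Xc Xd /(finj _ _ (XD _ _ Xa Xb) (XD _ _ Xc Xd))[-> ->].
have [[h [hX hinj]]|[k [kX kinj]]] := injective_comparable X (~` X); last first.
  (* Here all of [K] injects into [X]: the tags [e 0] and [e 1] separate [X] from its complement. *)
  pose r a := if pselect (X a) then f (e 0, a) else f (e 1, k a).
  have rX a : X (r a).
    by rewrite /r; case: pselect => [Xa|nXa]; apply: fX => //; exact: kX.
  have rinj : injective r.
    move=> a b; rewrite /r.
    case: pselect => Xa; case: pselect => Xb.
    - by case/fI.
    - by case/fI => //; [exact: kX|move/e_inj].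
    - by case/fI => //; [exact: kX|move/e_inj].
    - by case/fI; rewrite ?Xe//; [exact: kX|exact: kX|move=> _ /kinj->].
  exists (fun p => f (r p.1, r p.2)) => -[a b] [c d] /= /fI[]//.
  by move=> /rinj-> /rinj->.
pose Y := X `|` h @` X.
(* [r] folds [Y] back onto [X]; a point of [Y] is determined by its image and by whether it lies in
   [X]. *)
pose r a := if pselect (exists2 x, X x & h x = a) is left p
  then sval (cid2 p) else a.
have rh x : X x -> r (h x) = x.
  move=> Xx; rewrite /r; case: pselect => [p|[]]; last by exists x.
  by case: cid2 => y Xy /= /hinj->.
have rX x : X x -> r x = x.
  move=> Xx; rewrite /r; case: pselect => // -[y Xy E].
  by have := hX y Xy; rewrite E.
have Yr a : Y a -> X (r a) by case=> [Xa|[x Xx <-]]; [rewrite rX|rewrite rh].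
have XN x : X x -> X (h x) = False by move=> /hX; rewrite /= propeqE; tauto.
have r_inj a b : Y a -> Y b -> `[< X a >] = `[< X b >] -> r a = r b -> a = b.
  move=> Ya Yb E; have {E} : X a <-> X b.
    by split=> /asboolP; [rewrite E|rewrite -E] => /asboolP.
  case: Ya => [Xa|[x Xx <-]]; case: Yb => [Xb|[y Xy <-]].
  - by rewrite !rX.
  - by rewrite XN//; tauto.
  - by rewrite XN//; tauto.
  - by rewrite !rh// => _ ->.
(* New pairs go to the image of [X] under [h], disjoint from [X]; the pickled booleans record the
   side of each coordinate lost by [r]. *)
pose f' p := if pselect (X p.1 /\ X p.2) then f p else
  h (f (e (choice.pickle (`[< X p.1 >], `[< X p.2 >])), f (r p.1, r p.2))).
have X'h (p : K * K) : Y p.1 -> Y p.2 ->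
    X (f (e (choice.pickle (`[< X p.1 >], `[< X p.2 >])), f (r p.1, r p.2))).
  by move=> Y1 Y2; exact: (fX _ _ (Xe _) (fX _ _ (Yr _ Y1) (Yr _ Y2))).
have f'D p : D p -> f' p = f p.
  case: p => a b /Dsq[Xa Xb]; rewrite /f'; case: pselect => // -[].
  by split.
suff : [set p | Y p.1 /\ Y p.2] `<=` D.
  move=> sub; case: (hX (e 0) (Xe 0)); apply: sub.
  by split; right; exists (e 0).
apply: (maxD _ f') => //.
  by move=> [a b] /Dsq[Xa Xb]; split; left.
split=> /=.
- by move=> a b; tauto.
- move=> [a b] /= [Ya Yb]; suff : Y (f' (a, b)) by [].
  rewrite /f'; case: pselect => /= [[Xa Xb]|_]; first by left; exact: fX.
  by right; eexists; [exact: (X'h (a, b) Ya Yb)|].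
- move=> [a b] [c d] /= [Ya Yb] [Yc Yd]; rewrite /f' /=.
  have X1 := X'h (a, b) Ya Yb; have X2 := X'h (c, d) Yc Yd.
  case: pselect => /= [[Xa Xb]|_]; case: pselect => /= [[Xc Xd]|_].
  + by move=> /fI[]// -> ->.
  + by move=> E; case: (hX _ X2); rewrite -E; exact: fX.
  + by move=> E; case: (hX _ X1); rewrite E; exact: fX.
  + move=> /(hinj _ _ X1 X2); case/fI => //; try by apply: fX; exact: Yr.
    move=> /e_inj/(pcan_inj choice.pickleK)[Eac Ebd]; case/fI; try exact: Yr.
    move=> /= Er Er'.
    by rewrite (r_inj _ _ Ya Yc Eac Er) (r_inj _ _ Yb Yd Ebd Er').
Qed.

(** The length is stored too, as the fold alone does not mark where the sequence ends. *)
Lemma seq_injection (K : Type) (e : nat -> K) :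
  injective e -> exists f : seq K -> K, injective f.
Proof.
move=> e_inj; have [f finj] := square_injection e_inj.
pose g := foldr (fun x y => f (x, y)) (e 0).
exists (fun l => f (e (size l), g l)) => l m /finj[/e_inj].
elim: l m => [|x l IH] [|y m] //= [sz] /finj[->] E.
by rewrite (IH m).
Qed.

Lemma tree_injection (K : Type) (e : nat -> K) (L : Type) (l : L -> K) :
  injective e -> injective l -> exists f : GenTree.tree L -> K, injective f.
Proof.
move=> e_inj l_inj; have [f finj] := square_injection e_inj.
have [g ginj] := seq_injection e_inj.
pose c (x : nat + L) := match x with
  | inl n => f (e 0, e n) | inr x => f (e 1, l x) end.
exists (fun t => g (map c (GenTree.encode t))).
have c_inj : injective c.
  move=> [m|x] [n|y] /= /finj[].
  - by move=> /e_inj->.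
  - by move=> /e_inj.
  - by move=> /e_inj.
  - by move=> /l_inj->.
by move=> s t /ginj/(inj_map c_inj)/(pcan_inj (@GenTree.codeK L)).
Qed.

Lemma card_le_setT_inj (T U : Type) (f : T -> U) :
  injective f -> [set: T] #<= [set: U].
Proof.
move=> f_inj.
have : {in [set: T] &, injective f} by move=> x y _ _; exact: f_inj.
move=> /Pinj[i _]; apply: (@card_le_trans _ _ _ (i @` setT)).
  by have := card_image i; rewrite card_eq_le => /andP[].
exact: subset_card_le.
Qed.

(** * Formulas with variables indexed by natural numbers *)

Inductive rawpp (S : Type) :=
| REq of S & nat & S & nat
| RAnd of rawpp S & rawpp S
| REx of rawpp S.

Definition scons (T : Type) (x : T) (v : nat -> T) i :=
  if i is j.+1 then v j else x.

(** Quantifiers are relativized to [D] while values stay in [C], so that satisfaction in different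
    subsets is compared without changing type. *)
Fixpoint sat (S : monoidType) (C : sact S) (D : set C) (p : rawpp S)
    (v : nat -> C) : Prop :=
  match p with
  | REq s i t j => sact_op s (v i) = sact_op t (v j)
  | RAnd p q => sat D p v /\ sat D q v
  | REx p => exists2 x, D x & sat D p (scons x v)
  end.

Fixpoint rename (S : Type) (p : rawpp S) (r : nat -> nat) : rawpp S :=
  match p with
  | REq s i t j => REq s (r i) t (r j)
  | RAnd p q => RAnd (rename p r) (rename q r)
  | REx p => REx (rename p (scons 0 (fun i => (r i).+1)))
  end.

Lemma sat_rename (S : monoidType) (C : sact S) (D : set C) (p : rawpp S) r v :
  sat D (rename p r) v <-> sat D p (v \o r).
Proof.
elim: p r v => [s i t j|p IHp q IHq|p IHp] r v //=; first by rewrite IHp IHq.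
by split=> -[x Dx xP]; exists x => //; move: xP; rewrite IHp;
  congr sat; apply/funext => -[].
Qed.

Lemma sat_mono (S : monoidType) (C : sact S) (D E : set C) (p : rawpp S) v :
  D `<=` E -> sat D p v -> sat E p v.
Proof.
move=> DE; elim: p v => [s i t j|p IHp q IHq|p IHp] v //=.
  by move=> [/IHp ? /IHq].
by move=> [x /DE Ex /IHp]; exists x.
Qed.

(** * Quantifier analysis over an LO monoid *)

(* [LOne i p] says that the value of [x_i] satisfies [p], all of whose
   variables are identified. *)
Inductive literal (S : Type) :=
| LEq of S & nat & S & nat
| LOne of nat & rawpp S.

Definition lsat (S : monoidType) (C : sact S) (D : set C) (v : nat -> C)
    (l : literal S) : Prop :=
  match l with
  | LEq s i t j => sact_op s (v i) = sact_op t (v j)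
  | LOne i p => sat D p (fun=> v i)
  end.

Fixpoint lsats (S : monoidType) (C : sact S) (D : set C) (v : nat -> C)
    (ls : seq (literal S)) : Prop :=
  if ls is l :: ls' then lsat D v l /\ lsats D v ls' else True.

Lemma lsats_cat (S : monoidType) (C : sact S) (D : set C) v
    (ls1 ls2 : seq (literal S)) :
  lsats D v (ls1 ++ ls2) <-> lsats D v ls1 /\ lsats D v ls2.
Proof. by elim: ls1 => [|l ls1 IH] /=; rewrite ?IH; tauto. Qed.

Definition link_sat (S : monoidType) (C : sact S) (x : C) (v : nat -> C)
    (k : option (S * S * nat)) : Prop :=
  if k is Some (t, q, j) then sact_op t x = sact_op q (v j) else True.

(** If [s = u * t], the link [t x = r (v i)] turns [s x = q (v j)] into [(u * r) (v i) = q (v j)],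
    which is free of [x]; the other case is symmetric. *)
Lemma LO_link (S : monoidType) (hS : LO S) (k : option (S * S * nat)) s q j :
  exists k' ls, forall (C : sact S) (D : set C) x v,
    sact_op s x = sact_op q (v j) /\ link_sat x v k <->
    link_sat x v k' /\ lsats D v ls.
Proof.
case: k => [[[t r] i]|] /=; last first.
  by exists (Some (s, q, j)), [::] => C D x v /=; tauto.
have [[u ->]|[u ->]] := hS s t.
- exists (Some (t, r, i)), [:: LEq (u * r)%g i q j] => C D x v /=.
  rewrite -!sactM; split=> [[<- E]|[E [<- _]]]; first by rewrite E.
  by rewrite E.
- exists (Some (s, q, j)), [:: LEq (u * q)%g j r i] => C D x v /=.
  rewrite -!sactM; split=> [[E <-]|[E [<- _]]]; first by rewrite E.
  by rewrite E.
Qed.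

(** Literals about [x] alone are merged into [p], equations joining [x] to a parameter are absorbed
    into the single link [k], and the rest goes to [ls']. *)
Lemma LO_isolate (S : monoidType) (hS : LO S) (ls : seq (literal S)) :
  exists p k ls', forall (C : sact S) (D : set C) x v,
    lsats D (scons x v) ls <->
    sat D p (fun=> x) /\ link_sat x v k /\ lsats D v ls'.
Proof.
elim: ls => [|l ls [p [k [ls' IH]]]].
  exists (REq 1%g 0 1%g 0), None, [::] => C D x v /=.
  by tauto.
have link s q j (E : forall (C : sact S) (D : set C) x v,
    lsat D (scons x v) l <-> sact_op s x = sact_op q (v j)) :
    exists p k ls', forall (C : sact S) (D : set C) x v,
    lsats D (scons x v) (l :: ls) <->
    sat D p (fun=> x) /\ link_sat x v k /\ lsats D v ls'.
  have [k' [ls2 K]] := LO_link hS k s q j.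
  exists p, k', (ls2 ++ ls') => C D x v /=.
  have := K C D x v; rewrite lsats_cat IH E => {}K.
  by tauto.
case: l link => [s [|i] t [|j]|[|i] q] link.
- exists (RAnd (REq s 0 t 0) p), k, ls' => C D x v /=.
  by rewrite IH; tauto.
- exact: (link s t j).
- by apply: (link t s i) => C D x v /=; split.
- exists p, k, (LEq s i t j :: ls') => C D x v /=.
  by rewrite IH; tauto.
- exists (RAnd q p), k, ls' => C D x v /=.
  by rewrite IH; tauto.
- exists p, k, (LOne i q :: ls') => C D x v /=.
  by rewrite IH; tauto.
Qed.

(* Over an LO monoid, all the equations [s x = t y_j] linking a variable [x] to
   others follow from the one with the largest [s], up to equations between the
   [y_j]; hence quantifying [x] leaves a condition on a single [y_j]. *)
Lemma LO_normal_form (S : monoidType) (hS : LO S) (p : rawpp S) :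
  exists ls, forall (C : sact S) (D : set C) v, sat D p v <-> lsats D v ls.
Proof.
elim: p => [s i t j|p [l1 H1] q [l2 H2]|p [l H]].
- by exists [:: LEq s i t j] => C D v /=; tauto.
- by exists (l1 ++ l2) => C D v /=; rewrite lsats_cat H1 H2.
have [q [k [ls E]]] := LO_isolate hS l.
have qE (C : sact S) (D : set C) v :
    sat D (rename q (fun=> 0)) v <-> sat D q (fun=> v 0).
  exact: sat_rename.
case: k E => [[[t r] j]|] E.
(* Under the new quantifier, index 0 is the bound variable and index 1, like all later ones, stands
   for [v j]. *)
- exists (LOne j (REx (RAnd (rename q (fun=> 0)) (REq t 0 r 1))) :: ls).
  move=> C D v /=.
  split=> [[x Dx /H/E[qx [kx lx]]]|[[x Dx [/qE qx kx]] lx]].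
    by split=> //; exists x => //; split => //; apply/qE.
  by exists x => //; apply/H/E.
(* Without a link the condition on [x] involves no parameter, so the index 0 is an arbitrary
   choice. *)
- exists (LOne 0 (REx (rename q (fun=> 0))) :: ls) => C D v /=.
  split=> [[x Dx /H/E[qx [_ lx]]]|[[x Dx /qE qx] lx]].
    by split=> //; exists x => //; apply/qE.
  by exists x => //; apply/H/E.
Qed.

Definition pointwise_pure (S : monoidType) (C : sact S) (D : set C) : Prop :=
  forall (p : rawpp S) d, D d -> sat setT p (fun=> d) -> sat D p (fun=> d).

(** In the normal form, equations do not depend on [D] and every other literal concerns a single
    point. *)
Lemma LO_pointwise_pure (S : monoidType) (hS : LO S) (C : sact S) (D : set C) :
  pointwise_pure D ->
  forall (p : rawpp S) v, (forall i, D (v i)) -> sat setT p v -> sat D p v.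
Proof.
move=> Dpure p v Dv; have [ls E] := LO_normal_form hS p.
rewrite !E; elim: ls {E} => //= l ls IH [lv /IH]; split=> //.
by case: l lv => //= i q; exact: Dpure.
Qed.

(** * Skolem hulls and their cardinality *)

Fixpoint rawpp_tree (S : Type) (p : rawpp S) : GenTree.tree S :=
  match p with
  | REq s i t j => GenTree.Node 0 [:: GenTree.Leaf s; GenTree.Node i [::];
                                      GenTree.Leaf t; GenTree.Node j [::]]
  | RAnd p q => GenTree.Node 1 [:: rawpp_tree p; rawpp_tree q]
  | REx p => GenTree.Node 2 [:: rawpp_tree p]
  end.

Lemma rawpp_tree_inj (S : Type) : injective (@rawpp_tree S).
Proof.
elim=> [s i t j|p IHp q IHq|p IHp] [s' i' t' j'|p' q'|p'] //=.
- by case=> -> -> -> ->.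
- by case=> /IHp-> /IHq->.
- by case=> /IHp->.
Qed.

(* The set of values of Skolem terms: [B] and [C] are both equipped with Skolem
   functions, so that the hull is pure and meets [B] in a pure subset. *)
Section SkolemHull.
Variables (S : monoidType) (C : sact S) (B : set C) (b c : C).

(** The head of [l] is the value of all variables beyond the list, so that a finite list encodes a
    valuation. *)
Definition skolem (D : set C) (p : rawpp S) (l : seq C) : C :=
  let d := head b l in
  if pselect (exists2 x, D x & sat D p (scons x (nth d (behead l)))) is left e
  then sval (cid2 e) else b.

(** Skolem terms are labelled trees so that [tree_injection] can count them. *)
Fixpoint hull_eval (t : GenTree.tree (S + rawpp S)) : C :=
  match t with
  | GenTree.Node 0 _ => c
  | GenTree.Node 1 [:: GenTree.Leaf (inl s); t] => sact_op s (hull_eval t)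
  | GenTree.Node 2 (GenTree.Leaf (inr p) :: ts) =>
      skolem setT p (map hull_eval ts)
  | GenTree.Node 3 (GenTree.Leaf (inr p) :: ts) =>
      skolem B p (map hull_eval ts)
  | _ => b
  end.

Definition hull : set C := range hull_eval.

Lemma hull_op s x : hull x -> hull (sact_op s x).
Proof.
by move=> [t _ <-]; exists (GenTree.Node 1 [:: GenTree.Leaf (inl s); t]).
Qed.

Lemma hull_seq d l : hull d -> (forall i, hull (nth d l i)) ->
  exists ts, map hull_eval ts = l.
Proof.
move=> hd; elim: l => [|x l IH] hl; first by exists [::].
have [ts <-] := IH (fun i => hl i.+1).
by have [t _ /= <-] := hl 0; exists (t :: ts).
Qed.

Lemma hull_skolem (D : set C) p d l : D = setT \/ D = B -> hull d ->
  (forall i, hull (nth d l i)) -> hull (skolem D p (d :: l)).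
Proof.
move=> DB hd hl; have [ts E] : exists ts, map hull_eval ts = d :: l.
  by apply: (@hull_seq d) => // -[|i] /=.
by case: DB => ->;
  [exists (GenTree.Node 2 (GenTree.Leaf (inr p) :: ts))|
   exists (GenTree.Node 3 (GenTree.Leaf (inr p) :: ts))] => //=; rewrite E.
Qed.

(** The induction runs over valuations given by a finite list followed by the constant [d]: Skolem
    functions accept these, and a witness only lengthens the list. *)
Lemma hull_sat (D : set C) p d : D = setT \/ D = B -> hull d ->
  sat D p (fun=> d) -> sat (D `&` hull) p (fun=> d).
Proof.
move=> DB hd; have -> : (fun=> d) = nth d [::] by apply/funext; case.
have : forall i, hull (nth d [::] i) by case.
elim: p [::] => [s i t j|p IHp q IHq|p IHp] l hl //=.
  by move=> [/IHp? /IHq?]; split; auto.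
move=> xP; pose x := skolem D p (d :: l).
have [Dx xsat] : D x /\ sat D p (scons x (nth d l)).
  by rewrite /x /skolem /=; case: pselect => // e; case: cid2.
have hx : hull x by exact: hull_skolem.
have E : scons x (nth d l) = nth d (x :: l) by apply/funext; case.
exists x => //; rewrite E; apply: IHp; last by rewrite -E.
by case.
Qed.

Lemma hull_base : hull b.
Proof. by exists (GenTree.Node 4 [::]). Qed.

Lemma hull_point : hull c.
Proof. by exists (GenTree.Node 0 [::]). Qed.

Lemma card_hull : [set: hull] #<= [set: (S + nat)%type].
Proof.
have e_inj : injective (inr : nat -> S + nat) by move=> m n [].
have l_inj : injective (inl : S -> S + nat) by move=> m n [].
have [f f_inj] := tree_injection e_inj l_inj.
(* The tree of a formula has a node at its root, so it is never a leaf. One tree coding bounds the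
   labels, a second one the Skolem terms. *)
pose l (x : S + rawpp S) :=
  f (match x with inl s => GenTree.Leaf s | inr p => rawpp_tree p end).
have {}l_inj : injective l.
  move=> [s|p] [t|q] /f_inj //.
  - by move=> [->].
  - by case: q.
  - by case: p.
  - by move=> /rawpp_tree_inj->.
have [g g_inj] := tree_injection e_inj l_inj.
have tree_of (x : hull) : exists t, hull_eval t = val x.
  by have [t _ E] := set_mem (valP x); exists t.
pose k x := g (sval (cid (tree_of x))).
apply: (@card_le_setT_inj _ _ k) => x y /g_inj.
by case: cid => t /= tx; case: cid => u /= uy tu; apply: val_inj;
  exact: etrans (esym tx) (etrans (congr1 _ tu) uy).
Qed.

End SkolemHull.

(** * Translation between [ppformula] and [rawpp] *)

Fixpoint raw_term (S : monoidType) n (t : term S n) : S * nat :=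
  match t with
  | TVar i => (1%g, val i)
  | TApp s u => ((s * (raw_term u).1)%g, (raw_term u).2)
  end.

Fixpoint raw_of_pp (S : monoidType) n (p : ppformula S n) : rawpp S :=
  match p with
  | PPEq _ t u =>
      REq (raw_term t).1 (raw_term t).2 (raw_term u).1 (raw_term u).2
  | PPAnd _ p q => RAnd (raw_of_pp p) (raw_of_pp q)
  | PPEx _ p => REx (raw_of_pp p)
  end.

(* All the variables of index at least [n] are identified with [x_n]. *)
Fixpoint pp_of_raw (S : monoidType) (p : rawpp S) n : ppformula S n.+1 :=
  match p with
  | REq s i t j => PPEq (TApp s (TVar S (inord (minn i n))))
                        (TApp t (TVar S (inord (minn j n))))
  | RAnd p q => PPAnd (pp_of_raw p n) (pp_of_raw q n)
  | REx p => PPEx (pp_of_raw p n.+1)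
  end.

Section RawFormulas.
Variables (S : monoidType) (A C : sact S) (f : A -> C).
Hypotheses (f_hom : shom f) (f_inj : injective f).

Lemma teval_raw n (a : n.-tuple A) (t : term S n) (e : C) :
  f (teval a t) = sact_op (raw_term t).1 (nth e (map f a) (raw_term t).2).
Proof.
elim: t => [i|s t IH] /=; last by rewrite f_hom IH sactM.
by rewrite sact1 -tnth_map (tnth_nth e).
Qed.

Lemma ppsat_raw_of_pp n (p : ppformula S n) (a : n.-tuple A) (e : C) :
  ppsat p a <-> sat (range f) (raw_of_pp p) (nth e (map f a)).
Proof.
elim: p a => {n} [n t u|n p IHp q IHq|n p IHp] a /=.
- by rewrite -!teval_raw; split=> [->//|/f_inj].
- by rewrite IHp IHq.
- have E x : nth e (map f [tuple of x :: a]) = scons (f x) (nth e (map f a)).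
    by apply/funext; case.
  split=> [[x /IHp]|[_ [x _ <-] xP]].
    by rewrite E => xP; exists (f x) => //; exists x.
  by exists x; apply/IHp; rewrite E.
Qed.

Lemma ppsat_pp_of_raw n (p : rawpp S) (a : n.+1.-tuple A) :
  ppsat (pp_of_raw p n) a <->
  sat (range f) p (fun i => f (tnth a (inord (minn i n)))).
Proof.
elim: p n a => [s i t j|p IHp q IHq|p IHp] n a /=.
- by rewrite -!f_hom; split=> [->//|/f_inj].
- by rewrite IHp IHq.
- have E x : (fun i => f (tnth [tuple of x :: a] (inord (minn i n.+1)))) =
      scons (f x) (fun i => f (tnth a (inord (minn i n)))).
    apply/funext => -[|i] /=; congr f; rewrite !(tnth_nth x) /=.
      by rewrite min0n inordK.
    by rewrite minnSS !inordK ?ltnS ?geq_minr.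
  split=> [[x /IHp]|[_ [x _ <-] xP]].
    by rewrite E => xP; exists (f x) => //; exists x.
  by exists x; apply/IHp; rewrite E.
Qed.

End RawFormulas.

(** * Purity of subacts and pointwise purity *)

Lemma range_subact_incl (S : monoidType) (C : sact S) (B : subact C) :
  range (@subact_incl S C B) = subact_set B.
Proof.
apply/seteqP; split=> [_ [x _ <-]|x Bx]; first exact: set_mem (valP x).
by exists (exist _ x (mem_set Bx)).
Qed.

(** The formula [pp_of_raw p 0] has one free variable; it is read in [C] through [id] and in [B]
    through the inclusion. *)
Lemma pure_subact_pointwise (S : monoidType) (C : sact S) (B : subact C) :
  pure_subact B -> pointwise_pure (subact_set B).
Proof.
move=> [_ Bpure] p d; rewrite -range_subact_incl => -[b _ <-] bp.
have /Bpure : ppsat (pp_of_raw p 0) (map_tuple (@subact_incl S C B) [tuple b]).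
  apply/(@ppsat_pp_of_raw S C C id) => //; rewrite image_id.
  by under eq_fun => i do rewrite tnth_map ord1 tnth0.
have incl_inj : injective (@subact_incl S C B) by exact: val_inj.
rewrite (ppsat_pp_of_raw _ incl_inj)//.
suff -> : (fun i => subact_incl (tnth [tuple b] (inord (minn i 0)))) =
  fun=> subact_incl b by [].
by apply/funext => i; rewrite ord1 tnth0.
Qed.

(** Both satisfactions are read inside [C]: what holds in [E] holds in [C], then descends to the
    image of [P] by [LO_pointwise_pure]. *)
Lemma LO_pure_subact (S : monoidType) (hS : LO S) (C : sact S) (E : subact C)
    (P : subact E) :
  pointwise_pure (@subact_incl S C E @` subact_set P) -> pure_subact P.
Proof.
move=> Ppure; split=> // n p a.
pose f (x : P) := subact_incl (subact_incl x).
have [x0] := sact_inh P.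
have f_inj : injective f by move=> x y /val_inj/val_inj.
have incl_inj : injective (@subact_incl S C E) by exact: val_inj.
have f_hom : shom f by [].
have incl_hom : shom (@subact_incl S C E) by [].
rewrite (ppsat_raw_of_pp f_hom f_inj _ _ (f x0)).
rewrite (ppsat_raw_of_pp incl_hom incl_inj _ _ (f x0)).
rewrite /= -map_comp.
split; first by apply: sat_mono => _ [x _ <-]; exists (@subact_incl S E P x).
move=> /(sat_mono (@subsetT _ _)).
apply: (LO_pointwise_pure hS) => [|i].
  suff -> : range f = @subact_incl S C E @` subact_set P by [].
  by rewrite -range_subact_incl image_comp.
(* Indices beyond the tuple take the default [f x0], which also comes from [P]. *)
have [i_lt|/(nth_default (f x0))->] := ltnP i (size (map f a)).
  by rewrite (nth_map x0) -?(size_map f)//; exists (nth x0 a i).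
by exists x0.
Qed.

(* The cardinal |S| + aleph_0 is that of the disjoint sum S + nat. *)
Theorem theorem4p6 (S : monoidType) (hS : LO S) (A : sact S) :
  pure_injective A <->
  (forall (C : sact S) (B : subact C), pure_subact B ->
   [set: C] #<= [set: (S + nat)%type] ->
   forall f : B -> A, shom f ->
   exists g : C -> A, shom g /\ forall b : B, g (subact_incl b) = f b).
Proof.
split=> [Ainj C B Bpure _ f f_hom|Asmall C B Bpure f f_hom]; first exact: Ainj.
have [a0] := sact_inh A.
(* [zorn_partial_fun] handles total functions, hence the value [a0] outside [B]. *)
pose f0 z := if pselect (subact_set B z) is left Bz
  then f (exist _ z (mem_set Bz)) else a0.
have f0E (b : B) : f0 (val b) = f b.
  rewrite /f0; case: pselect => [Bb|[]]; last exact: set_mem (valP b).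
  by congr f; apply: val_inj.
pose Q (D : set C) (g : C -> A) := [/\ forall s z, D z -> D (sact_op s z),
  pointwise_pure D & forall s z, D z -> g (sact_op s z) = sact_op s (g z)].
have [||D [g [[Dop Dpure g_hom] BD gf maxD]]] :=
  @zorn_partial_fun _ _ Q (subact_set B) f0.
- split; [by move=> s z; exact: subact_closed|exact: pure_subact_pointwise|].
  move=> s z Bz; pose b : B := exist _ z (mem_set Bz).
  by have := f_hom s b; rewrite -!f0E.
- move=> D g _ loc; split.
  + move=> s z Dz; have [D' [g' [D'z _ sub [D'op _ _] _]]] := loc z z Dz Dz.
    exact/sub/D'op.
  + move=> p z Dz; have [D' [g' [D'z _ sub [_ D'pure _] _]]] := loc z z Dz Dz.
    by move=> /(D'pure _ _ D'z); exact: sat_mono.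
  + move=> s z Dz.
    have [D' [g' [D'z _ sub [D'op _ hom] E]]] := loc z z Dz Dz.
    by rewrite !E ?hom//; exact: D'op.
suff DT c : D c.
  exists g; split=> [s z|b]; first exact: g_hom.
  by rewrite gf ?f0E//; exact: set_mem (valP b).
(* Basing the hull at a point [b] of [B] makes it meet [D]. *)
have [b Bb] := subact_neq0 B; have Db := BD _ Bb.
pose E := Subact (ex_intro _ b (hull_base D b c)) (@hull_op S C D b c).
pose P : set E := [set x | D (val x)].
have P0 : P !=set0 by exists (exist _ b (mem_set (hull_base D b c))).
pose Psub := @Subact S E P P0 (fun s x => Dop s (val x)).
have imP : @subact_incl S C E @` P = D `&` hull D b c.
  apply/seteqP; split=> [_ [x Px <-]|x [Dx hx]].
    by split=> //; exact: set_mem (valP x).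
  by exists (exist _ x (mem_set hx)).
have Ppure : pure_subact Psub.
  (* Truth passes from [C] to [D] by purity of [D], then to the intersection by the Skolem functions
     of [D]. *)
  apply: (LO_pure_subact hS); rewrite imP => p d [Dd hd] /(Dpure _ _ Dd).
  by apply: hull_sat => //; right.
have [|h [h_hom hE]] :=
  Asmall E Psub Ppure (card_hull D b c) (fun x => g (val (val x))).
  move=> s x; apply: g_hom; exact: set_mem (valP x).
(* Gluing: [h] on the hull, [g] elsewhere; they agree on the intersection by [hE]. *)
pose g' z := if pselect (hull D b c z) is left hz
  then h (exist _ z (mem_set hz)) else g z.
have g'h (x : E) : g' (val x) = h x.
  rewrite /g'; case: pselect => [hz|[]]; last exact: set_mem (valP x).
  by congr h; apply: val_inj.
have g'D z : D z -> g' z = g z.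
  move=> Dz; have [hz|nhz] := pselect (hull D b c z); last first.
    by rewrite /g'; case: pselect.
  pose x : E := exist _ z (mem_set hz).
  have Px : P x by [].
  by have := hE (exist _ x (mem_set Px)); rewrite /= -g'h.
apply: (maxD (D `|` hull D b c) g'); [by left|by []| |].
- split.
  + by move=> s z [/Dop|/hull_op]; [left|right].
  (* A one-variable formula concerns one point, which lies in one of two pure sets. *)
  + move=> p z [Dz|hz] pz.
      by apply: sat_mono (Dpure _ _ Dz pz) => ?; left.
    have := @hull_sat S C D b c setT p z (or_introl erefl) hz pz.
    by apply: sat_mono => x [_ hx]; right.
  + move=> s z [Dz|hz]; first by rewrite !g'D ?g_hom//; exact: Dop s z Dz.
    pose x : E := exist _ z (mem_set hz).
    by have := h_hom s x; rewrite -!g'h.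
- by right; exact: hull_point.
Qed.
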